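(* Consider a density $f\in\mathcal{S}$. For all $z\ge0$, $$\mathbb{P}\left(P_n\left(\ln(f/f_* )\right)\ge\frac{z}{n}\right)\le\exp(-z).$$ Moreover, if one can take a finite quantity $v$ satisfying $v\ge\int(f\vee f_* )\left(\ln\left(\frac{f}{f_*}\right)\right)^2d\mu$, then for all $z\ge0$, $$\mathbb{P}\left((P_n-P)\left(\ln(f/f_* )\right)\ge\sqrt{\frac{2vz}{n}}+\frac{2z}{n}\right)\le\exp(-z).$$
   Context: $(\mathcal{Z},\mathcal{T})$ is a measurable space, $\mu$ a probability measure on it, and $\xi_1,\dots,\xi_n$ ($n\ge1$) are i.i.d. with law $P$ on $(\mathcal{Z},\mathcal{T})$ admitting a density $f_*=dP/d\mu$. $P_n=\frac1n\sum_{i=1}^n\delta_{\xi_i}$ is the empirical measure; for measurable $g$, $P(g)=\int g\,dP$, $P_n(g)=\frac1n\sum_i g(\xi_i)$. We write $a\vee b=\max(a,b)$. Conventions: $\ln0=-\infty$, $0\ln0=0$, $x_+=\max(x,0)$. The class $\mathcal{S}$ is $$\mathcal{S}=\left\{f:\mathcal{Z}\to\mathbb{R}_+;\ \int_{\mathcal{Z}}f\,d\mu=1\ \text{and}\ P(\ln f)_+<\infty\right\},$$ and it is assumed that $f_*\in\mathcal{S}$. *)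

(* Defs.v *)
From HB Require Import structures.
From mathcomp Require Import all_boot all_order all_algebra.
From mathcomp Require Import all_classical all_reals all_analysis.

Set Implicit Arguments.
Unset Strict Implicit.
Unset Printing Implicit Defensive.

Import Order.TTheory GRing.Theory Num.Theory.
Import numFieldNormedType.Exports.

Local Open Scope classical_set_scope.
Local Open Scope ring_scope.
Local Open Scope ereal_scope.

Definition has_density (R : realType) (d : measure_display)
    (Z : measurableType d) (mu P : {measure set Z -> \bar R})
    (f : Z -> R) : Prop :=
  [/\ measurable_fun [set: Z] f,
      forall x, (0 <= f x)%R &
      forall A, measurable A -> P A = \int[mu]_(x in A) (f x)%:E].

(* [^\+] is the positive part, and [lne 0 = -oo]. *)
Definition density_class (R : realType) (d : measure_display)
    (Z : measurableType d) (mu P : probability Z R) : set (Z -> R) :=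
  [set f : Z -> R | [/\ measurable_fun [set: Z] f,
               forall x, (0 <= f x)%R,
               \int[mu]_x (f x)%:E = 1 &
               \int[P]_x ((fun y => lne (f y)%:E)^\+ x) < +oo]].

Definition mutually_independent (R : realType) (dO d : measure_display)
    (Omega : measurableType dO) (Z : measurableType d)
    (Pr : probability Omega R) (I : finType)
    (xi : I -> {RV Pr >-> Z}) : Prop :=
  forall (J : {set I}) (A : I -> set Z),
    (forall i, i \in J -> measurable (A i)) ->
    Pr (\bigcap_(i in [set` J]) (xi i @^-1` A i)) =
    \prod_(i in J) Pr (xi i @^-1` A i).

Definition iid_with_law (R : realType) (dO d : measure_display)
    (Omega : measurableType dO) (Z : measurableType d)
    (Pr : probability Omega R) (P : probability Z R) (I : finType)
    (xi : I -> {RV Pr >-> Z}) : Prop :=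
  mutually_independent xi /\
  forall i A, measurable A -> distribution Pr (xi i) A = P A.

(* The quotient is the extended-real one: [c%:E / 0 = +oo] for [0 < c], so the
   value is [+oo] where [f > 0 = g] and [-oo] where [f = 0].  In particular it
   is [-oo] where [f = g = 0]. *)
Definition log_ratio (R : realType) (T : Type) (f g : T -> R) (x : T) : \bar R :=
  lne ((f x)%:E / (g x)%:E).

(* P_n(g) at the outcome [w].  A sum of extended reals in which both infinities
   occur is [-oo]; for [g = log_ratio f fstar], with [fstar] the density of the
   law of the sample, the value [+oo] is taken with probability zero. *)
Definition empirical_mean (R : realType) (dO d : measure_display)
    (Omega : measurableType dO) (Z : measurableType d)
    (Pr : probability Omega R) (n : nat) (xi : 'I_n -> {RV Pr >-> Z})
    (g : Z -> \bar R) (w : Omega) : \bar R :=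
  (n%:R^-1)%:E * \sum_(i < n) g (xi i w).

(* Main.v *)
Require Import Defs.
From HB Require Import structures.
From mathcomp Require Import all_boot all_order all_algebra.
From mathcomp Require Import all_classical all_reals all_analysis.
From mathcomp Require Import measurable_realfun.
From mathcomp Require Import ring lra.

Set Implicit Arguments.
Unset Strict Implicit.
Unset Printing Implicit Defensive.

Import Order.TTheory GRing.Theory Num.Theory.
Import numFieldNormedType.Exports.

Local Open Scope classical_set_scope.
Local Open Scope ring_scope.
Local Open Scope ereal_scope.

(** Both bounds are instances of the Chernoff method for an i.i.d. sample: if
    [phi] is a nonnegative function with [P phi <= K], and an event forces
    [a <= \prod_i phi (xi i)], then by Markov's inequality and independence its
    probability is at most [K ^ n / a] (lemma [probability_le_iid_moment]).

    For the first bound take [phi = f / fstar] and [a = expR z].  Since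
    [P (f / fstar)] is the integral of [f] over the set where [fstar] does not
    vanish, it is at most 1 (lemma [likelihood_ratio_moment]), so [K = 1].

    For the second bound write [g = ln (f / fstar)] and take
    [phi = expR (l * (g - P g))] with [l] in the unit interval.  The elementary
    inequality [e^y <= 1 + y + y^2 / 2 * max(1, e^y)], applied to [y = l * g],
    gives [P (expR (l * g)) <= 1 + l * P g + l^2 / 2 * P (g^2 * max(1, e^g))].
    Now [e^g = f / fstar], hence [fstar * max(1, e^g) = max(f, fstar)], and the
    last moment is exactly the integral bounded by [v].  Therefore
    [K = expR (l^2 * v / 2)] is admissible for every [l] in the unit interval
    (lemma [exp_moment_centered]).  The optimal [l] of the sub-Gaussian
    regime is [sqrt (2 * z / (n * v))]; when it exceeds 1, the choice [l = 1]
    is paid for by the linear term [2 * z / n] (lemma [subgaussian_exponent]).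

    The product rule for expectations of independent variables and the
    change of variables [P phi = \int fstar * phi dmu] share one mechanism,
    [integral_weighted_comp], which extends an identity between set functions
    to all nonnegative functions.

    The points where [f] or [fstar] vanishes are handled as follows.  [P] does
    not charge [fstar = 0].  Where [fstar > 0 = f], a single such observation
    sends the empirical mean to [-oo], outside the events considered.  In the
    second bound the centering is also computed with the real function [g]; this
    is legitimate because finiteness of [v] forces [f > 0] [P]-almost surely
    (lemma [ae_log_ratio_fin]). *)

(** * Weighted changes of variables *)

Section weighted_comp.
Import HBNNSimple.

(** [Q] is the image under [X] of the measure with density [W], known only
    through its values on sets.  The identity extends to simple functions by
    linearity and to nonnegative functions by monotone convergence.  With
    [X = id] it integrates against a density; with [W] a product of functions
    of other variables it is the induction step of the product rule below. *)
Lemma integral_weighted_comp (R : realType) (d1 d2 : measure_display)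
    (T1 : measurableType d1) (T2 : measurableType d2)
    (nu : {measure set T1 -> \bar R}) (Q : {measure set T2 -> \bar R})
    (X : T1 -> T2) (W : T1 -> R) :
    measurable_fun [set: _] X -> measurable_fun setT W -> (forall x, 0 <= W x)%R ->
    (forall A, measurable A ->
      \int[nu]_x (W x * \1_A (X x))%:E = Q A) ->
  forall phi : T2 -> R, measurable_fun [set: _] phi -> (forall y, 0 <= phi y)%R ->
    \int[nu]_x (W x * phi (X x))%:E = \int[Q]_y (phi y)%:E.
Proof.
move=> mX mW W0 nuQ phi mphi phi0.
have mephi : measurable_fun [set: T2] (EFin \o phi) by exact/measurable_EFinP.
pose h := nnsfun_approx measurableT mephi.
have hphi x : (h n x)%:E @[n --> \oo] --> (phi x)%:E.
  by apply: (cvg_nnsfun_approx measurableT mephi) => // y _; rewrite lee_fin.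
have mhX n : measurable_fun [set: _] (fun x => (W x * h n (X x))%:E).
  by apply/measurable_EFinP/measurable_funM => //; apply: measurableT_comp.
transitivity (limn (fun n => \int[nu]_x (W x * h n (X x))%:E)).
  rewrite -monotone_convergence//.
  - apply: eq_integral => x _; apply/esym/cvg_lim => //.
    under eq_fun do rewrite EFinM.
    by rewrite EFinM; apply: cvgeZl.
  - by move=> n x _; rewrite lee_fin mulr_ge0.
  - move=> x _ m n mn; rewrite lee_fin ler_wpM2l//.
    exact/lefP/nd_nnsfun_approx.
transitivity (limn (fun n => \int[Q]_y (h n y)%:E)); last first.
  rewrite -monotone_convergence//.
  - by apply: eq_integral => x _; apply/cvg_lim.
  - by move=> n; apply/measurable_EFinP.
  - by move=> n x _; rewrite lee_fin.
  - by move=> x _ m n mn; rewrite lee_fin; exact/lefP/nd_nnsfun_approx.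
congr (limn _); apply/funext => n.
transitivity (\int[nu]_x
   (\sum_(r \in range (h n)) (r * (W x * \1_(h n @^-1` [set r]) (X x)))%:E)).
  apply: eq_integral => x _; rewrite fimfunE EFinM -fsumEFin//.
  rewrite ge0_mule_fsumr => [|r]; last exact: nnfun_muleindic_ge0.
  apply: eq_fsbigr => r _; rewrite -EFinM; congr EFin; ring.
transitivity (\int[Q]_y
   (\sum_(r \in range (h n)) (r * \1_(h n @^-1` [set r]) y)%:E)); last first.
  by apply: eq_integral => y _; rewrite fimfunE fsumEFin.
have rW r x : (0 <= r * (W x * \1_(h n @^-1` [set r]) (X x)))%R.
  rewrite mulrCA mulr_ge0//.
  by have := nnfun_muleindic_ge0 (h n) r (X x); rewrite lee_fin.
have mpre r : measurable (h n @^-1` [set r]) by [].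
have mWi r : measurable_fun [set: _]
    (fun x => (W x * \1_(h n @^-1` [set r]) (X x))%:E).
  apply/measurable_EFinP/measurable_funM => //.
  by apply: measurableT_comp.
rewrite !ge0_integral_fsum//; last 4 first.
- by move=> r; apply/measurable_EFinP/measurable_funM.
- by move=> r x _; exact: nnfun_muleindic_ge0.
- by move=> r; under eq_fun do rewrite EFinM; apply: measurable_funeM.
- by move=> r x _; rewrite lee_fin.
apply: eq_fsbigr => r; rewrite inE => -[y _ hyr].
have r0 : (0 <= r)%R by rewrite -hyr.
under eq_integral do rewrite EFinM.
under [RHS]eq_integral do rewrite EFinM.
rewrite !ge0_integralZl_EFin//.
- by rewrite nuQ// integral_indic// setIT.
- exact/measurable_EFinP.
- by move=> x _; rewrite lee_fin mulr_ge0.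
Qed.

End weighted_comp.

(** * Independent samples *)

(** Independence is the product rule for indicators.  The indicators are
    replaced by arbitrary functions one index at a time: with all other factors
    frozen into a weight [W], the set function [A |-> E[W * 1_A(xi i)]] is a
    multiple of the law of [xi i]. *)
Lemma expectation_prod_independent (R : realType) (dO d : measure_display)
    (Omega : measurableType dO) (Z : measurableType d)
    (Pr : probability Omega R) (I : finType) (xi : I -> {RV Pr >-> Z})
    (g : I -> Z -> R) (k : I -> R) :
    mutually_independent xi ->
    (forall i, measurable_fun [set: Z] (g i)) ->
    (forall i y, 0 <= g i y)%R ->
    (forall i, \int[Pr]_w (g i (xi i w))%:E = (k i)%:E) ->
  \int[Pr]_w (\prod_i g i (xi i w))%:E = (\prod_i k i)%:E.
Proof.
move=> indep.
(* [s] lists the indices whose factor is no longer required to be an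
   indicator. *)
suff main (s : seq I) : forall (g : I -> Z -> R) (k : I -> R),
    (forall i, i \notin s -> exists2 A, measurable A & g i = \1_A) ->
    (forall i, measurable_fun [set: Z] (g i)) ->
    (forall i y, 0 <= g i y)%R ->
    (forall i, \int[Pr]_w (g i (xi i w))%:E = (k i)%:E) ->
    \int[Pr]_w (\prod_i g i (xi i w))%:E = (\prod_i k i)%:E.
  by apply: (main (enum I)) => i; rewrite mem_enum.
elim: s {g k} => [|i s IH] g k gind mg g0 gk.
  have /choice[A mgA] : forall i, exists A, measurable A /\ g i = \1_A.
    by move=> i; have [//|A mA gA] := gind i; exists A.
  have mA i : measurable (A i) by case: (mgA i).
  have mpre i : measurable (xi i @^-1` A i) by exact: measurable_funPTI.
  have gE i w : g i (xi i w) = \1_(xi i @^-1` A i) w.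
    by case: (mgA i) => _ ->; rewrite !indicE.
  transitivity (\int[Pr]_w
      (\1_(\bigcap_(i in [set` [set: I]%SET]) (xi i @^-1` A i)) w)%:E).
    apply: eq_integral => w _; congr EFin.
    under eq_bigr do rewrite gE.
    rewrite [in RHS]indicE.
    have [/set_mem wA|wA] := boolP (w \in _).
      rewrite big1// => i _; rewrite indicE mem_set//; apply: wA => /=.
      by rewrite inE.
    apply/eqP; rewrite prodf_seq_eq0; apply/hasP.
    have : ~ forall i, (xi i @^-1` A i) w.
      by move=> h; move/negP: wA; apply; rewrite inE => i _; exact: h.
    move=> /existsNP[i wi]; exists i; first exact: mem_index_enum.
    by rewrite /= indicE memNset.
  rewrite integral_indic//; last first.
    by apply: fin_bigcap_measurable => //; exact: finite_finset.
  rewrite setIT; apply: (eq_trans (indep [set: I]%SET A (fun i _ => mA i))).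
  rewrite -prodEFin; apply: eq_big => [i|i _]; first by rewrite inE.
  rewrite -gk; under eq_integral do rewrite gE.
  by rewrite integral_indic// setIT.
have k0 j : (0 <= k j)%R.
  by rewrite -lee_fin -gk; apply: integral_ge0 => w _; rewrite lee_fin.
have c0 : (0 <= \prod_(j | j != i) k j)%R by exact: prodr_ge0.
pose W w := (\prod_(j | j != i) g j (xi j w))%R.
have mgxi j : measurable_fun [set: Omega] (fun w => g j (xi j w)).
  by apply: measurableT_comp.
have mW : measurable_fun [set: Omega] W.
  rewrite /W; under eq_fun do rewrite big_mkcond/=.
  by apply: measurable_prod => j _; case: (j != i).
pose Q : {measure set Z -> \bar R} :=
  mscale (NngNum c0) (distribution Pr (xi i)).
transitivity (\int[Pr]_w (W w * g i (xi i w))%:E).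
  by apply: eq_integral => w _; rewrite (bigD1 i)//= mulrC.
rewrite (@integral_weighted_comp _ _ _ _ _ _ Q)//; last 2 first.
- by move=> w; apply: prodr_ge0.
- move=> A mA.
  pose g' j := if j == i then \1_A else g j.
  pose k' j := if j == i then fine (Pr (xi i @^-1` A)) else k j.
  have mpre : measurable (xi i @^-1` A) by exact: measurable_funPTI.
  transitivity (\int[Pr]_w (\prod_j g' j (xi j w))%:E).
    apply: eq_integral => w _; rewrite (bigD1 i)//= /g' eqxx mulrC.
    by congr (_ * _)%:E; apply: eq_bigr => j /negbTE ->.
  rewrite (IH g' k'); first last.
  + move=> j; rewrite /g' /k'; case: ifP => [/eqP ->|//].
    rewrite fineK ?fin_num_measure// -[X in _ = Pr X]setIT -integral_indic//.
  + by move=> j y; rewrite /g'; case: ifP.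
  + by move=> j; rewrite /g'; case: ifP => // _; exact: measurable_indic.
  + move=> j js; rewrite /g'; case: ifPn => [_|ji]; first by exists A.
    by apply: gind; rewrite inE negb_or ji.
  rewrite (bigD1 i)//= /k' eqxx EFinM fineK ?fin_num_measure// muleC.
  rewrite /Q/= /mscale/=; congr (_%:E * _).
  by apply: eq_bigr => j /negbTE ->.
rewrite ge0_integral_mscale//.
- rewrite ge0_integral_distribution//.
  + by rewrite gk/= -EFinM [in RHS](bigD1 i)//= mulrC.
  + exact/measurable_EFinP.
  + by move=> y; rewrite lee_fin.
- exact/measurable_EFinP.
- by move=> y _; rewrite lee_fin.
Qed.

(** The null set [N] lets the pointwise inequality fail at values the sample
    almost surely avoids. *)
Lemma probability_le_iid_moment (R : realType) (dO d : measure_display)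
    (Omega : measurableType dO) (Z : measurableType d)
    (Pr : probability Omega R) (P : probability Z R) (I : finType)
    (xi : I -> {RV Pr >-> Z}) (xi_iid : iid_with_law P xi)
    (phi : Z -> R) (K a : R) (N : set Z) (A : set Omega) :
    measurable_fun [set: Z] phi -> (forall y, 0 <= phi y)%R ->
    \int[P]_y (phi y)%:E <= K%:E -> (0 < a)%R ->
    measurable N -> P N = 0 -> measurable A ->
    (forall w, A w -> (forall i, ~ N (xi i w)) ->
      (a <= \prod_i phi (xi i w))%R) ->
  Pr A <= (K ^+ #|I| / a)%:E.
Proof.
move=> mphi phi0 phiK a0 mN PN0 mA Aprod; have [indep law] := xi_iid.
have mephi : measurable_fun [set: Z] (EFin \o phi) by exact/measurable_EFinP.
have int0 : 0 <= \int[P]_y (phi y)%:E.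
  by apply: integral_ge0 => y _; rewrite lee_fin.
have intfin : \int[P]_y (phi y)%:E \is a fin_num.
  by rewrite ge0_fin_numE// (le_lt_trans phiK)// ltry.
pose k := fine (\int[P]_y (phi y)%:E).
have k0 : (0 <= k)%R by exact: fine_ge0.
have kK : (k <= K)%R by rewrite -lee_fin fineK.
have intk i : \int[Pr]_w (phi (xi i w))%:E = k%:E.
  rewrite fineK//; transitivity (\int[distribution Pr (xi i)]_y (phi y)%:E).
    by rewrite ge0_integral_distribution// => y; rewrite lee_fin.
  by apply: eq_measure_integral => B mB _; exact: law.
have prod0 w : (0 <= \prod_i phi (xi i w))%R by exact: prodr_ge0.
have mprod : measurable_fun [set: Omega]
    (fun w => (\prod_i phi (xi i w))%:E).
  apply/measurable_EFinP; apply: measurable_prod => i _.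
  by apply: measurableT_comp.
have Eprod : \int[Pr]_w (\prod_i phi (xi i w))%:E = (k ^+ #|I|)%:E.
  rewrite (expectation_prod_independent indep (g := fun=> phi) (k := fun=> k))//.
  by rewrite prodr_const.
have -> : Pr A = \int[Pr]_w (\1_A w)%:E by rewrite integral_indic// setIT.
apply: (@le_trans _ _ (\int[Pr]_w (a^-1%:E * (\prod_i phi (xi i w))%:E))).
  apply: ae_ge0_le_integral => //.
  - exact/measurable_EFinP.
  - by move=> w _; rewrite lee_fin mulr_ge0// invr_ge0 ltW.
  - exact: measurable_funeM.
  - have : {ae Pr, forall w i, ~ N (xi i w)}.
      apply: filter_forall => i; exists (xi i @^-1` N); split.
      + exact: measurable_funPTI.
      + by rewrite -[RHS]PN0 -(law i).
      + by move=> w /= /contrapT.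
    apply: filterS => w wN _; rewrite lee_fin indicE.
    have [/set_mem wA|_] := boolP (w \in A).
      by rewrite mulrC ler_pdivlMr// mul1r Aprod.
    by rewrite mulr_ge0// invr_ge0 ltW.
rewrite ge0_integralZl_EFin//; last 2 first.
- by move=> w _; rewrite lee_fin.
- by rewrite invr_ge0 ltW.
rewrite Eprod -EFinM lee_fin mulrC; apply: ler_wpM2r.
  by rewrite invr_ge0 ltW.
by rewrite lerXn2r// nnegrE (le_trans k0).
Qed.

(** * The extended log-likelihood ratio *)

Lemma log_ratio_numer0 (R : realType) (T : Type) (f g : T -> R) x :
  f x = 0%R -> log_ratio f g x = -oo.
Proof. by rewrite /log_ratio => ->; rewrite mul0e le0_lneNy. Qed.

Lemma log_ratio_denom0 (R : realType) (T : Type) (f g : T -> R) x :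
  (0 < f x)%R -> g x = 0%R -> log_ratio f g x = +oo.
Proof. by rewrite /log_ratio => f0 ->; rewrite inve0 gt0_muley. Qed.

Lemma log_ratio_pos (R : realType) (T : Type) (f g : T -> R) x :
  (0 < f x)%R -> (0 < g x)%R -> log_ratio f g x = (ln (f x / g x))%:E.
Proof.
by move=> f0 g0; rewrite /log_ratio inver gt_eqF// -EFinM lne_EFin// divr_gt0.
Qed.

Section ratio.
Context (R : realType) (d : measure_display) (Z : measurableType d).
Variables (f g : Z -> R).
Hypotheses (mf : measurable_fun [set: Z] f) (mg : measurable_fun [set: Z] g).
Hypotheses (f0 : forall x, (0 <= f x)%R) (g0 : forall x, (0 <= g x)%R).

(** On [g > 0] division by [g] is multiplication by [expR (- ln g)], a
    composition of measurable functions; on [g = 0] the quotient is 0. *)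
Lemma measurable_ratio : measurable_fun [set: Z] (fun x => f x / g x)%R.
Proof.
have -> : (fun x => f x / g x)%R =
    (fun x => if g x == 0%R then 0%R else f x * expR (- ln (g x)))%R.
  apply/funext => x; case: ifPn => [/eqP ->|gx0]; first by rewrite invr0 mulr0.
  by rewrite expRN lnK// posrE lt_neqAle eq_sym gx0 g0.
apply: measurable_fun_ifT => //; first exact: measurable_fun_eqr.
apply: measurable_funM => //; apply: measurableT_comp => //.
by apply: measurableT_comp => //; exact: measurableT_comp.
Qed.

Lemma measurable_ln_ratio : measurable_fun [set: Z] (fun x => ln (f x / g x)).
Proof. by apply: measurableT_comp => //; exact: measurable_ratio. Qed.

Lemma measurable_log_ratio : measurable_fun [set: Z] (log_ratio f g).
Proof.
have -> : log_ratio f g = fun x => if f x == 0%R then -oo else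
    if g x == 0%R then +oo else (ln (f x / g x))%:E.
  apply/funext => x; case: ifPn => [/eqP fx0|fx0]; first by rewrite log_ratio_numer0.
  have fx : (0 < f x)%R by rewrite lt_neqAle eq_sym fx0 f0.
  case: ifPn => [/eqP gx0|gx0]; first by rewrite log_ratio_denom0.
  by rewrite log_ratio_pos// lt_neqAle eq_sym gx0 g0.
apply: measurable_fun_ifT => //; first exact: measurable_fun_eqr.
apply: measurable_fun_ifT => //; first exact: measurable_fun_eqr.
exact/measurable_EFinP/measurable_ln_ratio.
Qed.

Context (dO : measure_display) (Omega : measurableType dO).
Variables (Pr : probability Omega R) (n : nat) (xi : 'I_n -> {RV Pr >-> Z}).

Lemma measurable_empirical_mean (L : Z -> \bar R) :
  measurable_fun [set: Z] L -> measurable_fun [set: Omega] (empirical_mean xi L).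
Proof.
move=> mL; rewrite /empirical_mean; apply: measurable_funeM.
by apply: emeasurable_sum => i; exact: measurableT_comp.
Qed.

(** Once [g] is positive along the sample, no term of the sum is [+oo], so one
    term [-oo] would make the whole mean [-oo]; a finite lower bound on the mean
    excludes this and all terms are real logarithms. *)
Lemma le_empirical_log_ratio (w : Omega) (t : R) : (0 < n)%N ->
    (forall i, 0 < g (xi i w))%R ->
    t%:E <= empirical_mean xi (log_ratio f g) w ->
  (forall i, 0 < f (xi i w))%R /\
  (n%:R * t <= \sum_i ln (f (xi i w) / g (xi i w)))%R.
Proof.
move=> n0 gpos tle.
have nV0 : (0 < (n%:R : R)^-1)%R by rewrite invr_gt0 ltr0n.
have fpos i : (0 < f (xi i w))%R.
  rewrite lt_neqAle f0 andbT; apply: contraPneq tle => /esym fi0.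
  rewrite /empirical_mean (esum_eqNyP _ _ _).2; last first.
    by exists i; rewrite mem_index_enum log_ratio_numer0.
  by rewrite gt0_muleNy ?lte_fin// leNgt ltNyr.
split=> //; move: tle; rewrite /empirical_mean.
under eq_bigr do rewrite log_ratio_pos//.
by rewrite sumEFin -EFinM lee_fin -ler_pdivrMl// invrK.
Qed.

End ratio.

(** * Exponential moments *)

(** After multiplication by [expR (- x)] this says that
    [x^2 / 2 + (1 + x) * expR (- x)], which is 1 at the origin, increases. *)
Lemma expR_le_quadratic_ge0 (R : realType) (x : R) :
  (0 <= x -> expR x <= 1 + x + x ^+ 2 / 2 * expR x)%R.
Proof.
move=> x0.
pose h (y : R) := (y ^+ 2 / 2 + (1 + y) * expR (- y))%R.
have dh (y : R) : is_derive y (1%R : R) h (y * (1 - expR (- y)))%R.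
  apply: is_derive_eq; rewrite /GRing.scale/= !mulr1.
  by field.
have : (h 0%R <= h x)%R.
  apply: (@ger0_derive1_ndecry _ h 0%R) => //.
  - move=> y; rewrite in_itv/= andbT => y0.
    rewrite derive1E derive_val; apply: mulr_ge0; first exact: ltW.
    by rewrite subr_ge0 -expR0 ler_expR oppr_le0 ltW.
  - apply: derivable_within_continuous => y _.
    by have [] := dh y.
rewrite /h expr0n/= mul0r oppr0 expR0 addr0 mulr1 add0r => hx.
have := ler_wpM2r (expR_ge0 x) hx.
by rewrite mul1r mulrDl -(mulrA (1 + x)%R) [(expR (- x) * _)%R]mulrC expRxMexpNx_1; lra.
Qed.

Lemma expR_le_quadratic_le0 (R : realType) (x : R) :
  (x <= 0 -> expR x <= 1 + x + x ^+ 2 / 2)%R.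
Proof.
move=> x0.
pose h (y : R) := (1 - y + y ^+ 2 / 2 - expR (- y))%R.
have dh (y : R) : is_derive y (1%R : R) h (expR (- y) - (1 + - y))%R.
  apply: is_derive_eq; rewrite /GRing.scale/= !mulr1.
  by field.
have : (h 0%R <= h (- x))%R.
  apply: (@ger0_derive1_ndecry _ h 0%R) => //; last by rewrite oppr_ge0.
  - by move=> y _; rewrite derive1E derive_val subr_ge0 expR_ge1Dx.
  - apply: derivable_within_continuous => y _.
    by have [] := dh y.
by rewrite /h expr0n/= mul0r oppr0 expR0 opprK sqrrN; lra.
Qed.

(** The scale [l] stays outside the maximum because [expR (l * x)] lies between
    1 and [expR x]; a single moment of [x] then controls every [l]. *)
Lemma expR_le_quadratic (R : realType) (l x : R) : (0 <= l <= 1)%R ->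
  (expR (l * x) <= 1 + l * x + l ^+ 2 / 2 * (x ^+ 2 * Num.max 1 (expR x)))%R.
Proof.
move=> /andP[l0 l1]; have [x0|x0] := leP x 0%R.
- have -> : Num.max 1%R (expR x) = 1%R.
    by apply/max_idPl; rewrite -expR0 ler_expR.
  have := @expR_le_quadratic_le0 _ (l * x)%R (mulr_ge0_le0 l0 x0).
  by rewrite exprMn mulr1; lra.
- have -> : Num.max 1%R (expR x) = expR x.
    by apply/max_idPr; rewrite -expR0 ler_expR ltW.
  have := @expR_le_quadratic_ge0 _ (l * x)%R (mulr_ge0 l0 (ltW x0)).
  have elx : (expR (l * x) <= expR x)%R by rewrite ler_expR ler_piMl// ltW.
  have sq0 : (0 <= (l * x) ^+ 2 / 2)%R by rewrite divr_ge0 ?sqr_ge0.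
  by have := ler_wpM2l sq0 elx; rewrite exprMn; lra.
Qed.

(** The centering cancels the linear term of [expR_le_quadratic], and
    [1 + y <= expR y] turns the rest into an exponential.  Integrability of [g]
    comes from [`|g| <= 1 + g^2]. *)
Lemma exp_moment_centered (R : realType) (d : measure_display)
    (Z : measurableType d) (P : probability Z R) (g : Z -> R) (v : R) :
    measurable_fun [set: Z] g ->
    \int[P]_x (g x ^+ 2 * Num.max 1 (expR (g x)))%:E <= v%:E ->
  P.-integrable [set: Z] (EFin \o g) /\
  forall l : R, (0 <= l <= 1)%R ->
    \int[P]_x (expR (l * (g x - fine (\int[P]_y (g y)%:E))))%:E
      <= (expR (l ^+ 2 * v / 2))%:E.
Proof.
move=> mg gv.
pose q x := (g x ^+ 2 * Num.max 1 (expR (g x)))%R.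
have max1 x : (1 <= Num.max 1 (expR (g x)))%R by rewrite le_max lexx.
have q0 x : (0 <= q x)%R.
  by rewrite mulr_ge0 ?sqr_ge0// (le_trans ler01).
have mq : measurable_fun [set: Z] q.
  apply: measurable_funM; first exact: measurable_funX.
  by apply: measurable_maxr => //; exact: measurableT_comp.
have mege : measurable_fun [set: Z] (EFin \o g) by exact/measurable_EFinP.
have meqe : measurable_fun [set: Z] (EFin \o q) by exact/measurable_EFinP.
have iq : P.-integrable [set: Z] (EFin \o q).
  apply/integrableP; split=> //.
  under eq_integral do rewrite /= ger0_norm//.
  by rewrite (le_lt_trans gv)// ltry.
have i1 : P.-integrable [set: Z] (cst 1%:E).
  exact: finite_measure_integrable_cst.
have ig : P.-integrable [set: Z] (EFin \o g).
  apply: (le_integrable measurableT _ _ (integrableD measurableT i1 iq)) => //.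
  move=> x _ /=; rewrite lee_fin [leRHS]ger0_norm; last by rewrite addr_ge0.
  have : (g x ^+ 2 <= q x)%R.
    by rewrite -[leLHS]mulr1 ler_wpM2l ?sqr_ge0.
  rewrite -real_normK ?num_real//.
  by have := sqr_ge0 (`|g x| - 1)%R; rewrite sqrrB1; have := normr_ge0 (g x); lra.
split=> // l l01; have /andP[l0 l1] := l01.
set m := fine _.
have gm : \int[P]_y (g y)%:E = m%:E.
  by rewrite fineK//; exact: integrable_fin_num.
have mE : measurable_fun [set: Z] (fun x => expR (l * g x)).
  by apply: measurableT_comp => //; exact: measurable_funM.
have meE : measurable_fun [set: Z] (fun x => (expR (l * g x))%:E).
  exact/measurable_EFinP.
have ilg := integrableZl measurableT l ig.
have ilq := integrableZl measurableT (l ^+ 2 / 2)%R iq.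
have i1lg := integrableD measurableT i1 ilg.
have irhs := integrableD measurableT i1lg ilq.
have Ele : \int[P]_x (expR (l * g x))%:E <= (1 + l * m + l ^+ 2 / 2 * v)%:E.
  apply: (@le_trans _ _ (\int[P]_x
      (1%:E + l%:E * (g x)%:E + (l ^+ 2 / 2)%:E * (q x)%:E))).
    apply: le_integral => //.
      apply: (le_integrable measurableT _ _ irhs) => // x _ /=.
      rewrite lee_fin !ger0_norm ?expR_ge0//; first exact: expR_le_quadratic.
      by rewrite (le_trans (expR_ge0 _) (expR_le_quadratic _ l01)).
    by move=> x _; rewrite lee_fin; exact: expR_le_quadratic.
  rewrite integralD// integralD// integral_cst// !integralZl// gm.
  have P1 : (P : {measure set Z -> \bar R}) [set: Z] = 1 := probability_setT P.
  rewrite mul1e P1 -EFinM -EFinD [leRHS]EFinD; apply: leeD2l.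
  by rewrite [leRHS]EFinM; apply: lee_wpmul2l; rewrite // lee_fin divr_ge0 ?sqr_ge0.
have -> : \int[P]_x (expR (l * (g x - m)))%:E =
    (expR (- (l * m)))%:E * \int[P]_x (expR (l * g x))%:E.
  rewrite -ge0_integralZl_EFin ?expR_ge0//.
  by apply: eq_integral => x _; rewrite -EFinM -expRD mulrBr addrC.
apply: (@le_trans _ _ ((expR (- (l * m)))%:E * (1 + l * m + l ^+ 2 / 2 * v)%:E)).
  by rewrite lee_wpmul2l// lee_fin expR_ge0.
rewrite -EFinM lee_fin.
apply: (@le_trans _ _ (expR (- (l * m)) * expR (l * m + l ^+ 2 / 2 * v))%R).
  by rewrite ler_wpM2l ?expR_ge0// -addrA expR_ge1Dx.
by rewrite -expRD addKr [(_ * v / 2)%R]mulrAC.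
Qed.

(** Minimising over [l] gives [l = sqrt (2 * z / (n * v))], written [s / v] with
    [s = sqrt (2 * v * z / n)]; it is at most 1 exactly when [2 * z <= v * n].
    Otherwise [l = 1] makes the first term at most [z], while the linear part
    of the deviation contributes [- 2 * z]. *)
Lemma subgaussian_exponent (R : realType) (n v z : R) :
    (0 < n)%R -> (0 <= v)%R -> (0 <= z)%R ->
  exists2 l : R, (0 <= l <= 1)%R &
    (n * (l ^+ 2 * v / 2) - l * (n * (Num.sqrt (2 * v * z / n) + 2 * z / n))
      <= - z)%R.
Proof.
move=> n0 v0 z0; set s := Num.sqrt _.
have nN0 : n != 0%R by rewrite gt_eqF.
have s0 : (0 <= s)%R by exact: sqrtr_ge0.
have s2 : (s ^+ 2 = 2 * v * z / n)%R.
  by rewrite sqr_sqrtr//; apply: divr_ge0; [rewrite !mulr_ge0|exact: ltW].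
have [vz|zv] := leP (v * n)%R (2 * z)%R.
  exists 1%R; first by rewrite ler01 lexx.
  have -> : (1 * (n * (s + 2 * z / n)) = n * s + 2 * z)%R by field.
  have := mulr_ge0 (ltW n0) s0; lra.
have vgt0 : (0 < v)%R.
  by rewrite -(pmulr_lgt0 _ n0) (le_lt_trans _ zv)// mulr_ge0.
have vN0 : v != 0%R by rewrite gt_eqF.
exists (s / v)%R.
  rewrite divr_ge0//= ler_pdivrMr// mul1r -ler_sqr ?nnegrE// s2.
  by rewrite ler_pdivrMr//; have := ler_wpM2l v0 (ltW zv); lra.
have -> : (n * ((s / v) ^+ 2 * v / 2) = z)%R.
  by rewrite expr_div_n s2; field; rewrite nN0 vN0.
have -> : (s / v * (n * (s + 2 * z / n)) = 2 * z + 2 * (s / v * z))%R.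
  have -> : (s / v * (n * (s + 2 * z / n)) = n / v * s ^+ 2 + 2 * (s / v * z))%R.
    by field; rewrite nN0 vN0.
  by rewrite s2; field; rewrite nN0 vN0.
by have : (0 <= s / v * z)%R; [rewrite mulr_ge0// divr_ge0|lra].
Qed.

(** * Integration against the true density *)

Lemma measurable_zero_set (R : realType) (d : measure_display)
    (Z : measurableType d) (h : Z -> R) :
  measurable_fun [set: Z] h -> measurable [set x | h x = 0%R].
Proof.
by move=> mh; have := mh measurableT _ (measurable_set1 0%R); rewrite setTI.
Qed.

Section density.
Context (R : realType) (d : measure_display) (Z : measurableType d).
Variables (mu P : probability Z R) (fstar : Z -> R).
Hypothesis fstar_density : has_density mu P fstar.

Lemma integral_density (phi : Z -> R) :
    measurable_fun [set: Z] phi -> (forall x, 0 <= phi x)%R ->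
  \int[P]_x (phi x)%:E = \int[mu]_x (fstar x * phi x)%:E.
Proof.
move=> mphi phi0; have [mfs fs0 PE] := fstar_density.
have wP A : measurable A -> \int[mu]_x (fstar x * \1_A x)%:E = P A.
  move=> mA; rewrite PE// [RHS]integral_mkcond; apply: eq_integral => x _.
  by rewrite epatch_indic EFinM.
exact/esym/(integral_weighted_comp (@measurable_id _ _ _) mfs fs0 wP).
Qed.

Lemma density_zero_null : P [set x | fstar x = 0%R] = 0.
Proof.
have [mfs fs0 PE] := fstar_density.
rewrite PE; last exact: measurable_zero_set.
by apply: integral0_eq => x /= ->.
Qed.

Variable f : Z -> R.
Hypotheses (mf : measurable_fun [set: Z] f) (f0 : forall x, (0 <= f x)%R).

Let g x := ln (f x / fstar x).

(** This is an inequality because [f] may put mass where [fstar = 0]. *)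
Lemma likelihood_ratio_moment : \int[mu]_x (f x)%:E = 1 ->
  \int[P]_x (f x / fstar x)%:E <= 1.
Proof.
move=> f1; have [mfs fs0 _] := fstar_density.
have mr := measurable_ratio mf mfs fs0.
rewrite integral_density//; last by move=> x; rewrite divr_ge0.
rewrite -f1; apply: ge0_le_integral => //.
- by move=> x _; rewrite lee_fin mulr_ge0// divr_ge0.
- exact/measurable_EFinP/measurable_funM.
- exact/measurable_EFinP.
move=> x _; rewrite lee_fin mulrCA.
have [->|fsN0] := eqVneq (fstar x) 0%R; first by rewrite mul0r mulr0.
by rewrite mulfV// mulr1.
Qed.

Variable v : R.
Hypothesis fv :
  \int[mu]_x ((Num.max (f x) (fstar x))%:E * log_ratio f fstar x ^+ 2) <= v%:E.

Let M x := (Num.max (f x) (fstar x))%:E * log_ratio f fstar x ^+ 2.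

Let M_ge0 x : 0 <= M x.
Proof. by rewrite mule_ge0 ?sqre_ge0// lee_fin le_max f0. Qed.

Let mM : measurable_fun [set: Z] M.
Proof.
have [mfs fs0 _] := fstar_density.
apply: emeasurable_funM; first exact/measurable_EFinP/measurable_maxr.
have mL := measurable_log_ratio mf mfs f0 fs0.
by under eq_fun do rewrite expe2; exact: emeasurable_funM.
Qed.

(** Where both densities are positive, [fstar * max(1, f / fstar)] equals
    [max(f, fstar)] and the two integrands agree; elsewhere the left one
    vanishes, since [ln 0 = 0] for the real logarithm. *)
Lemma weighted_log_ratio_moment :
  \int[P]_x (g x ^+ 2 * Num.max 1 (expR (g x)))%:E <= v%:E.
Proof.
have [mfs fs0 _] := fstar_density.
have mg : measurable_fun [set: Z] g by exact: measurable_ln_ratio.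
have phi0 x : (0 <= g x ^+ 2 * Num.max 1 (expR (g x)))%R.
  by rewrite mulr_ge0 ?sqr_ge0// le_max ler01.
have mphi : measurable_fun [set: Z]
    (fun x => g x ^+ 2 * Num.max 1 (expR (g x)))%R.
  apply: measurable_funM; first exact: measurable_funX.
  by apply: measurable_maxr => //; exact: measurableT_comp.
rewrite integral_density//; apply: le_trans fv.
apply: ge0_le_integral => //.
- by move=> x _; rewrite lee_fin mulr_ge0.
- exact/measurable_EFinP/measurable_funM.
move=> x _; rewrite -/(M x).
have [fs|fsN0] := eqVneq (fstar x) 0%R; first by rewrite fs mul0r.
have [fx|fN0] := eqVneq (f x) 0%R.
  by rewrite /g fx mul0r ln0// expr0n/= mul0r mulr0.
have fsgt0 : (0 < fstar x)%R by rewrite lt_neqAle eq_sym fsN0 fs0.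
have fgt0 : (0 < f x)%R by rewrite lt_neqAle eq_sym fN0 f0.
rewrite /M log_ratio_pos// -EFin_expe -EFinM lee_fin -/(g x).
rewrite {2}/g lnK ?posrE ?divr_gt0// mulrCA mulrC maxr_pMr//.
by rewrite mulr1 (mulrCA (fstar x)) mulfV// mulr1 maxC.
Qed.

(** Where [f = 0 < fstar] the integrand [M] is [+oo], so a finite integral makes
    this set null for [mu], hence for [P]. *)
Lemma ae_log_ratio_fin : {ae P, forall x, log_ratio f fstar x = (g x)%:E}.
Proof.
have [mfs fs0 PE] := fstar_density.
pose B := [set x | f x = 0%R] `\` [set x | fstar x = 0%R].
have mB : measurable B by apply: measurableD; exact: measurable_zero_set.
have iM : mu.-integrable [set: Z] M.
  apply/integrableP; split=> //.
  under eq_integral do rewrite gee0_abs//.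
  by rewrite (le_lt_trans fv)// ltry.
have muB : mu B = 0.
  apply/(negligibleP _ mB).
  apply: negligibleS (integrable_ae measurableT iM) => x [/= fx fsN0] /(_ I).
  rewrite /M log_ratio_numer0// expe2 mulNyNy gt0_muley//.
  rewrite lte_fin lt_max; apply/orP; right.
  by rewrite lt_neqAle eq_sym fs0 andbT; apply/eqP.
have PB : P B = 0.
  by rewrite PE// null_set_integral//; exact/measurable_funTS/measurable_EFinP.
exists (B `|` [set x | fstar x = 0%R]); split.
- by apply: measurableU => //; exact: measurable_zero_set.
- by apply: null_set_setU => //; [exact: measurable_zero_set|exact: density_zero_null].
move=> x /= Lx; have [fs|fsN0] := eqVneq (fstar x) 0%R; [by right|left].
split; last exact/eqP.
apply: contrapT => /eqP fN0; apply: Lx.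
by rewrite log_ratio_pos// lt_neqAle eq_sym ?fN0 ?fsN0 ?f0 ?fs0.
Qed.

End density.

(** * The deviation bounds *)

Theorem proposition4p4 (R : realType)
    (d : measure_display) (Z : measurableType d)
    (mu P : probability Z R) (fstar : Z -> R)
    (fstar_density : has_density mu P fstar)
    (fstarS : density_class mu P fstar)
    (dO : measure_display) (Omega : measurableType dO)
    (Pr : probability Omega R)
    (n : nat) (n_ge1 : (1 <= n)%N)
    (xi : 'I_n -> {RV Pr >-> Z}) (xi_iid : iid_with_law P xi)
    (f : Z -> R) (fS : density_class mu P f) :
  (forall z : R, (0 <= z)%R ->
     Pr [set w | (z / n%:R)%:E <= empirical_mean xi (log_ratio f fstar) w]
       <= (expR (- z))%:E)
  /\
  (forall v : R,
     \int[mu]_x ((Num.max (f x) (fstar x))%:E * log_ratio f fstar x ^+ 2)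
       <= v%:E ->
     forall z : R, (0 <= z)%R ->
     Pr [set w | (Num.sqrt (2 * v * z / n%:R) + 2 * z / n%:R)%:E
                 <= empirical_mean xi (log_ratio f fstar) w
                    - \int[P]_x log_ratio f fstar x]
       <= (expR (- z))%:E).
Proof.
have [mfs fs0 _] := fstar_density; have [mf f0 f1 _] := fS.
have n0 : (0 < n%:R :> R)%R by rewrite ltr0n.
have nN0 : n%:R != 0%R :> R by rewrite gt_eqF.
have mL := measurable_log_ratio mf mfs f0 fs0.
have mE := measurable_empirical_mean xi mL.
have mr := measurable_ratio mf mfs fs0.
have mg := measurable_ln_ratio mf mfs fs0.
have mN := measurable_zero_set mfs.
have PN := density_zero_null fstar_density.
have mtail (t : R) : measurable
    [set w | t%:E <= empirical_mean xi (log_ratio f fstar) w].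
  by have := emeasurable_fun_c_infty measurableT mE t%:E; rewrite setTI.
have fstar_gt0 w : (forall i, ~ fstar (xi i w) = 0%R) ->
    (forall i, 0 < fstar (xi i w))%R.
  by move=> wN i; rewrite lt_neqAle fs0 andbT eq_sym; apply/eqP.
split=> [z z0|v fv z z0].
  have := @probability_le_iid_moment _ _ _ _ _ _ _ _ xi xi_iid
    (fun x => f x / fstar x)%R 1%R (expR z) _ _ mr _
    (likelihood_ratio_moment fstar_density mf f0 f1) (expR_gt0 z) mN PN
    (mtail (z / n%:R)%R).
  rewrite expr1n div1r -expRN; apply => [x|w /= wz wN].
    by rewrite divr_ge0.
  have gpos := fstar_gt0 _ wN.
  have [fpos] := le_empirical_log_ratio f0 n_ge1 gpos wz.
  rewrite mulrC divfK// -ler_expR expR_sum => /le_trans; apply.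
  by apply: ler_prod => i _; rewrite expR_ge0 lnK ?posrE ?divr_gt0/=.
have [ig mgf] := exp_moment_centered mg (weighted_log_ratio_moment fstar_density mf f0 fv).
set m := fine (\int[P]_y (ln (f y / fstar y))%:E) in mgf.
have PL : \int[P]_x log_ratio f fstar x = m%:E.
  rewrite fineK; last exact: integrable_fin_num.
  apply: ae_eq_integral => //; first exact/measurable_EFinP.
  by apply: filterS (ae_log_ratio_fin fstar_density mf f0 fv) => x + _.
have v0 : (0 <= v)%R.
  rewrite -lee_fin; apply: le_trans fv; apply: integral_ge0 => x _.
  by rewrite mule_ge0 ?sqre_ge0// lee_fin le_max f0.
have [l l01 lz] := subgaussian_exponent n0 v0 z0; have /andP[l0 _] := l01.
set t := (Num.sqrt (2 * v * z / n%:R) + 2 * z / n%:R)%R in lz *.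
have -> : [set w | t%:E <= empirical_mean xi (log_ratio f fstar) w
                 - \int[P]_x log_ratio f fstar x] =
    [set w | (t + m)%:E <= empirical_mean xi (log_ratio f fstar) w].
  by apply/seteqP; split=> w /=; rewrite PL leeBrDr.
have mphi : measurable_fun [set: Z]
    (fun x => expR (l * (ln (f x / fstar x) - m))).
  by apply: measurableT_comp => //; apply: measurable_funM => //;
    exact: measurable_funB.
have := @probability_le_iid_moment _ _ _ _ _ _ _ _ xi xi_iid
  _ _ (expR (l * (n%:R * t))) _ _ mphi (fun x => expR_ge0 _)
  (mgf l l01) (expR_gt0 _) mN PN (mtail (t + m)%R).
move=> tail; apply: (le_trans (tail _)) => [w /= wz wN|].
  have [_ sumge] := le_empirical_log_ratio f0 n_ge1 (fstar_gt0 _ wN) wz.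
  rewrite -expR_sum ler_expR -mulr_sumr ler_wpM2l// big_split/= sumr_const.
  by rewrite card_ord -mulr_natl; move: sumge; lra.
rewrite lee_fin card_ord -expRM_natl -expRB ler_expR.
by apply: le_trans lz; rewrite -/t.
Qed.
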